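(* Let $k\in\mathbb{N}$. If there exists a lattice-like unit-distance graph $G=(V,E)$ with origin $v_0\in V$ that does not admit a proper $k$-colouring with bichromatic origin $v_0$, then $\chi(\mathbb{R}^2)\ge k+1$.
   Context: A unit-distance graph in the plane has $V\subseteq\mathbb{R}^2$ and $(v,w)\in E$ implies $\|v-w\|=1$. A lattice $\mathcal{L}=\{n_1v_1+n_2v_2:n_1,n_2\in\mathbb{Z}\}$ ($v_1,v_2$ linearly independent) is rotatable if for every $0\le\alpha_1<\alpha_2\le\pi$ there are $\alpha\in(\alpha_1,\alpha_2)$ and $\lambda>0$ with $\lambda\rho_\alpha(\mathcal{L})\subseteq\mathcal{L}$, $\rho_\alpha$ the rotation by $\alpha$ about the origin. $G$ with origin $v_0$ is lattice-like if there is a rotatable lattice containing $v_0$ and all its neighbours, and $v_0$ is not in the convex hull of its neighbours. A proper $k$-colouring with bichromatic origin $v_0$ assigns a one-element subset of $[k]$ to each $v\neq v_0$ and a two-element subset of $[k]$ to $v_0$ so that adjacent vertices receive disjoint sets. $\chi(\mathbb{R}^2)$ is the least $k$ such that there is $\varphi:\mathbb{R}^2\to[k]$ with $\varphi(p)\neq\varphi(q)$ whenever $\|p-q\|=1$. *)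

(* Defs.v *)
From mathcomp Require Import all_boot all_order all_algebra.
From mathcomp Require Import all_classical all_reals all_analysis.
From mathcomp Require Import zify ring lra.

Set Implicit Arguments.
Unset Strict Implicit.
Unset Printing Implicit Defensive.

Import Order.TTheory GRing.Theory Num.Theory.

Local Open Scope classical_set_scope.
Local Open Scope ring_scope.

(* The norm provided by the library on row vectors is the sup norm, hence the
   explicit Euclidean norm below. *)
Definition enorm (R : realType) (v : 'rV[R]_2) : R :=
  Num.sqrt (v 0 0 ^+ 2 + v 0 1 ^+ 2).

Definition rotation (R : realType) (a : R) (v : 'rV[R]_2) : 'rV[R]_2 :=
  \row_j (if j == 0 then cos a * v 0 0 - sin a * v 0 1
          else sin a * v 0 0 + cos a * v 0 1).

Definition convex_hull (R : realType) (E : lmodType R) (A : set E) : set E :=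
  smallest (@convex_set R E) A.

Definition is_lattice (R : realType) (L : set 'rV[R]_2) : Prop :=
  exists v1 v2 : 'rV[R]_2, free [:: v1; v2] /\
    L = [set v | exists n1 n2 : int, v = v1 *~ n1 + v2 *~ n2].

Definition rotatable (R : realType) (L : set 'rV[R]_2) : Prop :=
  forall a1 a2 : R, 0 <= a1 -> a1 < a2 -> a2 <= pi ->
    exists a l : R, [/\ a1 < a, a < a2, 0 < l &
      [set l *: rotation a v | v in L] `<=` L].

(* The vertex set may be infinite. *)
Record unit_distance_graph (R : realType) := UnitDistanceGraph {
  vertices : set 'rV[R]_2;
  adj : 'rV[R]_2 -> 'rV[R]_2 -> Prop;
  adj_sym : forall v w, adj v w -> adj w v;
  adj_vertices : forall v w, adj v w -> vertices v /\ vertices w;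
  adj_unit : forall v w, adj v w -> enorm (v - w) = 1 }.

Definition neighbours (R : realType) (G : unit_distance_graph R)
  (v : 'rV[R]_2) : set 'rV[R]_2 := [set w | adj G v w].

Definition lattice_like (R : realType) (G : unit_distance_graph R)
    (v0 : 'rV[R]_2) : Prop :=
  (exists L : set 'rV[R]_2,
     [/\ is_lattice L, rotatable L, L v0 & neighbours G v0 `<=` L]) /\
  ~ convex_hull (neighbours G v0) v0.

(* The values of c outside the vertex set are irrelevant. *)
Definition bichromatic_origin_coloring (R : realType)
    (G : unit_distance_graph R) (v0 : 'rV[R]_2) (k : nat)
    (c : 'rV[R]_2 -> {set 'I_k}) : Prop :=
  [/\ #|c v0| = 2%N,
      forall v, vertices G v -> v <> v0 -> #|c v| = 1%N &
      forall v w, adj G v w -> [disjoint c v & c w]%B].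

Definition plane_colorable (R : realType) (k : nat) : Prop :=
  exists phi : 'rV[R]_2 -> 'I_k,
    forall p q, enorm (p - q) = 1 -> phi p <> phi q.

(* Nine colours suffice: cut the plane into squares of side 1/2 and colour each
   square by its two integer coordinates modulo 3. *)
Lemma plane_colorable_ex (R : realType) :
  exists k, `[< plane_colorable R k >].
Proof.
pose f (x : R) : 'I_3 := inord `|(Num.floor (2 * x) %% 3)%Z|%N.
have fP (x y : R) : (x - y) ^+ 2 <= 1 -> f x = f y -> (x - y) ^+ 2 < 1 / 4.
  move=> dxy /(congr1 (@nat_of_ord 3)).
  rewrite /f !inordK; [|lia|lia] => e.
  have /andP[x1 x2] := floor_itv (2 * x).
  have /andP[y1 y2] := floor_itv (2 * y).
  move: x1 x2 y1 y2 e; set m := Num.floor _; set n := Num.floor _.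
  move=> x1 x2 y1 y2 e.
  have h1 : x - y <= 1 by nra.
  have h2 : -1 <= x - y by nra.
  rewrite !intrD in x2 y2.
  have mn : (m < n + 3)%R.
    by rewrite -(ltr_int R) intrD; lra.
  have nm : (n < m + 3)%R.
    by rewrite -(ltr_int R) intrD; lra.
  have {}mn : m = n by lia.
  by rewrite mn in x1 x2; nra.
exists #|{: 'I_3 * 'I_3}|; apply/asboolP.
exists (fun p : 'rV[R]_2 => enum_rank (f (p 0 0), f (p 0 1))).
move=> p q pq /enum_rank_inj[e0 e1].
have pq2 : (p 0 0 - q 0 0) ^+ 2 + (p 0 1 - q 0 1) ^+ 2 = 1.
  have := congr1 (fun x => x ^+ 2) pq.
  by rewrite /enorm sqr_sqrtr ?addr_ge0 ?sqr_ge0// !mxE expr1n.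
have s0 := sqr_ge0 (p 0 0 - q 0 0).
have s1 := sqr_ge0 (p 0 1 - q 0 1).
have := fP _ _ _ e0; have := fP _ _ _ e1.
lra.
Qed.

Definition plane_chromatic_number (R : realType) : nat :=
  ex_minn (plane_colorable_ex R).

(* Main.v *)
(** A proper colouring [phi] of the plane with [k] colours, on any rotated and
translated copy of [G], becomes a colouring with bichromatic origin as soon as
two points with different colours see the same colours on their
(translated) neighbourhoods.  So if no such colouring exists, the colours of
[p + rotation a w], for [w] a neighbour of the origin, determine the colour of
[p], for every angle [a].  Since the neighbours lie in an open half-plane,
far from the origin some rotation makes them all point inwards, and by
rotatability finitely many rotations, all mapping the lattice [L] into one
refinement [n^-1 L], suffice.  The colouring of a coset of [n^-1 L] is thus
determined by its restriction to a disc; by pigeonhole there is [B],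
independent of [phi], such that [B v] is a period of [phi] for all [v] in [L].
Applied to all rotations of [phi], this makes every vector of length [B] a
period, and a unit vector is a sum of two such vectors. *)

Require Import Defs.
From mathcomp Require Import all_boot all_order all_algebra.
From mathcomp Require Import all_classical all_reals all_analysis.
From mathcomp Require Import zify ring lra.

Set Implicit Arguments.
Unset Strict Implicit.
Unset Printing Implicit Defensive.

Import Order.TTheory GRing.Theory Num.Theory.
Import numFieldNormedType.Exports.

Local Open Scope classical_set_scope.
Local Open Scope ring_scope.

Section Plane.
Variable R : realType.
Implicit Types (u v w x y p q : 'rV[R]_2) (a b t : R) (L : set 'rV[R]_2).

(** * Planar vectors, their products and rotations *)

Definition dot u v : R := u 0 0 * v 0 0 + u 0 1 * v 0 1.

Definition cross u v : R := u 0 0 * v 0 1 - u 0 1 * v 0 0.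

Lemma row2P v w : v 0 0 = w 0 0 -> v 0 1 = w 0 1 -> v = w.
Proof.
move=> e0 e1; apply/rowP => j; case: (unliftP ord0 j) => [i|] ->; last exact: e0.
by rewrite [i]ord1 (_ : lift _ _ = 1)//; apply: val_inj.
Qed.

Lemma rotation0E a v : rotation a v 0 0 = cos a * v 0 0 - sin a * v 0 1.
Proof. by rewrite mxE. Qed.

Lemma rotation1E a v : rotation a v 0 1 = sin a * v 0 0 + cos a * v 0 1.
Proof. by rewrite mxE. Qed.

Definition coordE := (rotation0E, rotation1E, mxE).

Lemma enorm_eq1 v : enorm v = 1 <-> dot v v = 1.
Proof.
rewrite /enorm /dot -!expr2; split=> [e|->]; last by rewrite sqrtr1.
by rewrite -[LHS]sqr_sqrtr ?addr_ge0 ?sqr_ge0// e expr1n.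
Qed.

Lemma rotationD a v w : rotation a (v + w) = rotation a v + rotation a w.
Proof. by apply: row2P; rewrite !coordE; ring. Qed.

Lemma rotationZ a t v : rotation a (t *: v) = t *: rotation a v.
Proof. by apply: row2P; rewrite !coordE; ring. Qed.

Lemma rotationB a v w : rotation a (v - w) = rotation a v - rotation a w.
Proof. by rewrite -scaleN1r rotationD rotationZ scaleN1r. Qed.

Lemma rotation_add a b v : rotation (a + b) v = rotation a (rotation b v).
Proof. by apply: row2P; rewrite !coordE cosD sinD; ring. Qed.

Lemma rotation0 v : rotation 0 v = v.
Proof. by apply: row2P; rewrite !coordE cos0 sin0; ring. Qed.

Lemma dot_rotation a v w : dot (rotation a v) (rotation a w) = dot v w.
Proof.
have e := cos2Dsin2 a.
rewrite /dot !coordE -[RHS]mul1r -e; ring.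
Qed.

Lemma cross_rotation a v w : cross (rotation a v) (rotation a w) = cross v w.
Proof.
have e := cos2Dsin2 a.
rewrite /cross !coordE -[RHS]mul1r -e; ring.
Qed.

Lemma dot_ge0 v : 0 <= dot v v.
Proof. by rewrite /dot addr_ge0 // -expr2 sqr_ge0. Qed.

Lemma dot_eq0 v : dot v v = 0 -> v = 0.
Proof. by rewrite /dot => d; apply: row2P; rewrite mxE; nra. Qed.

Lemma cross_sqr_le v w : cross v w ^+ 2 <= dot v v * dot w w.
Proof.
rewrite (_ : dot v v * dot w w = cross v w ^+ 2 + dot v w ^+ 2).
  by rewrite lerDl sqr_ge0.
by rewrite /cross /dot; ring.
Qed.

Lemma angle_exists (c s : R) : c ^+ 2 + s ^+ 2 = 1 ->
  exists2 t, 0 <= t < pi *+ 2 & cos t = c /\ sin t = s.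
Proof.
move=> e; have pi0 := pi_gt0 R.
have cI : -1 <= c <= 1 by apply/andP; split; nra.
have cK : cos (acos c) = c by rewrite acosK// in_itv.
have sK : sin (acos c) = `|s|.
  by rewrite sin_acos// -e addrAC subrr add0r sqrtr_sqr.
have [s0|s0] := leP 0 s.
  exists (acos c).
    rewrite acos_ge0//= (le_lt_trans (acos_lepi cI))//.
    by rewrite mulr2n ltrDr.
  by rewrite sK ger0_norm.
(* Lower half circle: [acos c] is nonzero, as otherwise [s] would vanish, so this angle is strictly
   below a full turn. *)
exists (pi *+ 2 - acos c).
  rewrite subr_ge0 ltrBlDr ltrDl lt_neqAle acos_ge0// andbT.
  rewrite (le_trans (acos_lepi cI)) ?mulr2n ?lerDr ?ltW//=.
  by apply: contra_ltN s0 => /eqP c0; rewrite -c0 sin0 in sK;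
    move/esym/eqP: sK; rewrite normr_eq0 => /eqP->.
by rewrite cosB sinB !cos2pi !sin2pi !mul1r !mul0r addr0 sub0r cK sK ltr0_norm// opprK.
Qed.

(** As the lengths agree, [dot u v] and [cross u v] divided by [dot u u] are the cosine and sine of
    the angle from [u] to [v]. *)
Lemma rotation_onto u v : dot u u = dot v v -> u != 0 ->
  exists2 t, 0 <= t < pi *+ 2 & rotation t u = v.
Proof.
move=> e u0.
have d0 : dot u u != 0.
  by apply: contraNneq u0 => /dot_eq0 ->.
have [|t tI [ct st]] := @angle_exists (dot u v / dot u u) (cross u v / dot u u).
  rewrite !expr_div_n -mulrDl; apply/eqP; rewrite -(inj_eq (mulIf (expf_neq0 2 d0))).
  rewrite divfK ?expf_neq0// mul1r (_ : dot u u ^+ 2 = dot u u * dot v v).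
    by apply/eqP; rewrite /dot /cross; ring.
  by rewrite -e expr2.
exists t => //; apply: row2P; rewrite !coordE ct st; apply: (mulIf d0).
  rewrite [LHS](_ : _ = dot u v * u 0 0 - cross u v * u 0 1); last by field.
  by rewrite /dot /cross; ring.
rewrite [LHS](_ : _ = cross u v * u 0 0 + dot u v * u 0 1); last by field.
by rewrite /dot /cross; ring.
Qed.

(** * Separating a point from the hull of a finite set *)

Lemma seq_strict_lower_bound a (s : seq R) : (forall b, b \in s -> a < b) ->
  exists2 c, a < c & forall b, b \in s -> c < b.
Proof.
elim: s => [|b s IH] h; first by exists (a + 1) => //; rewrite ltrDl.
have [|c ac cs] := IH; first by move=> d ds; apply: h; rewrite inE ds orbT.
have ab : a < b by apply: h; rewrite inE eqxx.
exists (Num.min c ((a + b) / 2)); first by rewrite lt_min ac midf_lt.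
move=> d; rewrite inE gt_min => /orP[/eqP->|/cs->//].
by rewrite (midf_lt ab) orbT.
Qed.

(** Induction rather than a midpoint of maximum and minimum, since either list may be empty. *)
Lemma seq_separation (s1 s2 : seq R) :
  (forall a b, a \in s1 -> b \in s2 -> a < b) ->
  exists c, (forall a, a \in s1 -> a < c) /\ (forall b, b \in s2 -> c < b).
Proof.
elim: s1 => [_|a s IH h].
  elim: s2 => [|b s [c [_ cs]]]; first by exists 0.
  exists (Num.min c (b - 1)); split=> // d; rewrite inE gt_min.
  by move=> /orP[/eqP->|/cs->//]; rewrite ltrBlDr ltrDl ltr01 orbT.
have [|c [sc cs]] := IH; first by move=> d b ds; apply: h; rewrite inE ds orbT.
have [ac|ca] := ltP a c.
  by exists c; split=> // d; rewrite inE => /orP[/eqP->|/sc].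
have [|d ad ds2] := @seq_strict_lower_bound a s2.
  by move=> b; apply: h; rewrite inE eqxx.
exists d; split=> // b; rewrite inE => /orP[/eqP->//|/sc bc].
exact: lt_trans bc (le_lt_trans ca ad).
Qed.

Lemma convex_hull_segment (A : set 'rV[R]_2) x y t : 0 <= t <= 1 ->
  convex_hull A x -> convex_hull A y -> convex_hull A (t *: x + (1 - t) *: y).
Proof.
move=> tI Ax Ay C [Cc AC].
have tI' : Itv.spec (@Itv.num_sem R) (Itv.Real `[0%Z, 1%Z]) t.
  by rewrite /= /Itv.num_sem /= in_itv /= tI andbT ger0_real//; case/andP: tI.
have := Cc x y (Itv.mk tI'); rewrite !inE; apply.
- exact: Ax.
- exact: Ay.
Qed.

Lemma convex_hull_combination (A : set 'rV[R]_2) (z v w : 'rV[R]_2) a b :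
  0 <= a -> 0 <= b -> 0 < a + b -> convex_hull A v -> convex_hull A w ->
  a *: (v - z) + b *: (w - z) = 0 -> convex_hull A z.
Proof.
move=> a0 b0 ab Av Aw e.
have d0 : a + b != 0 by rewrite gt_eqF.
rewrite (_ : z = (a / (a + b)) *: v + (1 - a / (a + b)) *: w).
  apply: convex_hull_segment => //.
  by rewrite divr_ge0 ?addr_ge0//= ler_pdivrMr// mul1r lerDl.
rewrite (_ : 1 - a / (a + b) = b / (a + b)); last by field.
rewrite ![_ / (a + b)]mulrC -!scalerA -scalerDr.
apply: (scalerI d0); rewrite scalerA divff// scale1r.
apply/esym/eqP; rewrite -subr_eq0 -[X in _ == X]e; apply/eqP.
by rewrite !scalerBr scalerDl opprD addrACA.
Qed.

Lemma convex_hull_sub (A : set 'rV[R]_2) x : A x -> convex_hull A x.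
Proof. by move=> Ax C [_]; apply. Qed.

(* In coordinates adapted to one point [w0] the condition on the separating
   functional [(1, c)] is that its slope [c] lies between finitely many lower
   and upper bounds; a clash of two bounds exhibits [z] in the hull of three
   points. *)
Lemma finite_hull_separation (s : seq 'rV[R]_2) z :
  ~ convex_hull [set` s] z -> exists u, forall w, w \in s -> 0 < dot u (w - z).
Proof.
move=> hz; case: s hz => [|w0 s'] hz; first by exists 0.
set s := w0 :: s' in hz *.
have ws0 : w0 \in s by rewrite inE eqxx.
have hull w : w \in s -> convex_hull [set` s] w by move=> ws; exact: convex_hull_sub.
pose e := w0 - z; pose al w := dot e (w - z); pose be w := cross e (w - z).
have e0 : 0 < dot e e.
  rewrite lt_neqAle dot_ge0 andbT; apply/eqP => e0; apply: hz.
  by move/esym/dot_eq0/eqP: e0; rewrite subr_eq0 => /eqP <-; apply: hull.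
(* [f] is [e] turned by a right angle; [al] and [be] are the coordinates of [w - z] along [e] and
   [f], scaled by [dot e e]. *)
pose f : 'rV[R]_2 := \row_j (if j == 0 then - e 0 1 else e 0 0).
have dec w : dot e e *: (w - z) = al w *: e + be w *: f.
  by apply: row2P; rewrite !mxE /= /al /be /dot /cross !mxE; ring.
pose lo := [seq - (al w) / be w | w <- s & 0 < be w].
pose up := [seq al w / - be w | w <- s & be w < 0].
have [|c [loc cup]] := @seq_separation lo up.
  move=> a b /mapP[v]; rewrite mem_filter => /andP[v0 vs] ->.
  move=> /mapP[w]; rewrite mem_filter => /andP[w0' ws] ->.
  rewrite ltNge; apply/negP => h.
  have {}h : al v * - be w + al w * be v <= 0.
    move: h; rewrite ler_pdivrMr ?oppr_gt0// mulrAC ler_pdivlMr// => h.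
    by lra.
  (* This weight cancels the [f]-coordinates: the point of the segment differs from [z] by a
     nonpositive multiple of [e], so [z] lies between it and [w0]. *)
  pose r := - be w / (be v - be w).
  have x1 : convex_hull [set` s] (r *: v + (1 - r) *: w).
    apply: convex_hull_segment; [|exact: hull|exact: hull].
    rewrite /r divr_ge0 ?ler_pdivrMr ?mul1r; lra.
  have d0 : be v - be w != 0 by apply: lt0r_neq0; lra.
  apply: hz.
  apply: (@convex_hull_combination _ z _ w0
    ((be v - be w) * dot e e) (- (al v * - be w + al w * be v))) x1 (hull _ ws0) _.
  - by rewrite mulr_ge0 ?dot_ge0//; lra.
  - lra.
  - by rewrite ltr_wpDr ?oppr_ge0// mulr_gt0//; lra.
  rewrite -/e.
  transitivity ((- be w) *: (dot e e *: (v - z)) + be v *: (dot e e *: (w - z))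
      - (al v * - be w + al w * be v) *: e).
    by apply: row2P; rewrite /r !mxE; field; exact: d0.
  by rewrite !dec; apply: row2P; rewrite !mxE; ring.
exists (e + c *: f) => w ws.
rewrite (_ : dot _ _ = al w + c * be w); last first.
  by rewrite /al /be /dot /cross !mxE /=; ring.
have [b0|b0|b0] := ltgtP (be w) 0.
- have := cup (al w / - be w); rewrite ltr_pdivlMr ?oppr_gt0// => h.
  have := h (map_f _ _); rewrite mem_filter b0 ws => /(_ isT); lra.
- have := loc (- al w / be w); rewrite ltr_pdivrMr// => h.
  have := h (map_f _ _); rewrite mem_filter b0 ws => /(_ isT); lra.
(* Now [w - z] is a multiple of [e]; a nonpositive one would put [z] between [w] and [w0]. *)
rewrite b0 mulr0 addr0 ltNge; apply/negP => a0; apply: hz.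
apply: (@convex_hull_combination _ z w w0 (dot e e) (- al w)).
- exact: dot_ge0.
- lra.
- lra.
- exact: hull.
- exact: hull.
by rewrite dec b0 scale0r addr0 scaleNr -/e subrr.
Qed.

(** * Planar lattices *)

Lemma free_cross_neq0 v1 v2 : free [:: v1; v2] -> cross v1 v2 != 0.
Proof.
move=> /(@freeP _ _ _ [tuple v1; v2]) F; apply/eqP => c0.
have comb a b : a *: v1 + b *: v2 = 0 -> a = 0 /\ b = 0.
  move=> ab.
  have h := F (fun i : 'I_2 => if i == 0 then a else b).
  rewrite !big_ord_recl big_ord0 /= addr0 in h.
  by split; [exact: (h ab 0)|exact: (h ab 1)].
have e1 : v2 0 0 *: v1 + (- v1 0 0) *: v2 = 0.
  by apply: row2P; rewrite !mxE; move: c0; rewrite /cross => c0; lra.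
have e2 : v2 0 1 *: v1 + (- v1 0 1) *: v2 = 0.
  by apply: row2P; rewrite !mxE; move: c0; rewrite /cross => c0; lra.
have [a1 b1] := comb _ _ e1; have [a2 b2] := comb _ _ e2.
have v10 : v1 = 0 by apply: row2P; rewrite mxE; lra.
have [] := comb 1 0; last by move/eqP; rewrite oner_eq0.
by rewrite v10 scaler0 scale0r addr0.
Qed.

Lemma latticeB L v w : is_lattice L -> L v -> L w -> L (v - w).
Proof.
move=> [v1 [v2 [_ ->]]] [n1 [n2 ->]] [m1 [m2 ->]].
by exists (n1 - m1), (n2 - m2); rewrite !mulrzBr opprD addrACA.
Qed.

Lemma lattice0 L : is_lattice L -> L 0.
Proof. by move=> [v1 [v2 [_ ->]]]; exists 0, 0; rewrite !mulr0z addr0. Qed.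

Lemma latticeD L v w : is_lattice L -> L v -> L w -> L (v + w).
Proof.
move=> hL Lv Lw; rewrite -[w]opprK; apply: latticeB => //.
by rewrite -sub0r; apply: latticeB => //; exact: lattice0.
Qed.

Lemma latticeMn L v n : is_lattice L -> L v -> L (n%:R *: v).
Proof.
move=> hL Lv; rewrite scaler_nat; elim: n => [|n IH].
  by rewrite mulr0n; exact: lattice0.
by rewrite mulrS; apply: latticeD.
Qed.

Lemma mulrz_scale v (n : int) : v *~ n = n%:~R *: v.
Proof. by rewrite scaler_int. Qed.

(** By Cramer's rule the integer coordinates of [v], times the determinant [D] of the basis, are
    cross products of [v] with basis vectors, hence bounded. *)
Lemma lattice_ball_finite L a : is_lattice L ->
  exists s : seq 'rV[R]_2, forall v, L v -> dot v v <= a -> v \in s.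
Proof.
move=> [v1 [v2 [/free_cross_neq0 D0 ->]]].
set D := cross v1 v2 in D0.
have D2 : 0 < D ^+ 2 by rewrite exprn_even_gt0.
pose C := a * (dot v1 v1 + dot v2 v2) / D ^+ 2.
pose M := Num.truncn C.
pose rg : seq int := [seq (i%:Z - M%:Z)%R | i <- iota 0 (M + M).+1].
have rgP (n : int) : n%:~R ^+ 2 * D ^+ 2 <= a * (dot v1 v1 + dot v2 v2) -> n \in rg.
  rewrite -ler_pdivlMr// -/C => nC.
  (* An integer satisfies [|n| <= n ^ 2], so no square root is taken. *)
  have nM : (`|n| <= M)%N.
    rewrite truncn_ge_nat; last exact: le_trans (sqr_ge0 _) nC.
    apply: le_trans nC; rewrite natr_absz -rmorphXn /= ler_int.
    by rewrite expr2; nia.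
  by apply/mapP; exists `|(n + M%:Z)%R|%N; [rewrite mem_iota|]; lia.
have v1p := dot_ge0 v1; have v2p := dot_ge0 v2.
exists [seq v1 *~ i + v2 *~ j | i <- rg, j <- rg] => _ [n1 [n2 ->]].
rewrite !mulrz_scale; set v := _ + _ => va; have vp := dot_ge0 v.
have c1 : n1%:~R * D = cross v v2 by rewrite /D /cross !mxE; ring.
have c2 : n2%:~R * D = cross v1 v by rewrite /D /cross !mxE; ring.
apply/allpairsP; exists (n1, n2); split=> /=; last by rewrite /v !mulrz_scale.
  apply: rgP; rewrite -exprMn c1 (le_trans (cross_sqr_le _ _))//.
  by rewrite ler_pM// lerDr.
apply: rgP; rewrite -exprMn c2 (le_trans (cross_sqr_le _ _))// mulrC.
by rewrite ler_pM// lerDl.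
Qed.

(** The scaled rotation has an integer matrix in a basis of [L], with determinant [t ^+ 2]; applied
    twice, it scales by exactly that integer. *)
Lemma lattice_double_rotation L a t : is_lattice L -> 0 < t ->
  [set t *: rotation a v | v in L] `<=` L ->
  exists2 n : nat, (0 < n)%N &
    forall v, L v -> L (n%:R *: rotation (a *+ 2) v).
Proof.
move=> [v1 [v2 [/free_cross_neq0 D0 LE]]] t0 LL.
have LL' v : L v -> L (t *: rotation a v) by move=> Lv; apply: LL; exists v.
have L1 : L v1 by rewrite LE; exists 1, 0; rewrite mulr1z mulr0z addr0.
have L2 : L v2 by rewrite LE; exists 0, 1; rewrite mulr1z mulr0z add0r.
have [n nE] : exists n : int, t ^+ 2 = n%:~R.
  have := LL' _ L1; rewrite {1}LE => -[a1 [b1 e1]].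
  have := LL' _ L2; rewrite {1}LE => -[a2 [b2 e2]].
  exists (a1 * b2 - b1 * a2); apply: (mulIf D0).
  rewrite -[X in _ * X = _](cross_rotation a).
  rewrite (_ : _ * _ = cross (t *: rotation a v1) (t *: rotation a v2)).
    by rewrite e1 e2 !mulrz_scale /cross !mxE !rmorphB !rmorphM /=; ring.
  by rewrite /cross !coordE; ring.
have n0 : 0 < n by rewrite -(ltr_int R) -nE exprn_gt0.
exists `|n|%N; first by lia.
move=> v Lv; rewrite natr_absz gtr0_norm// -nE.
rewrite mulr2n rotation_add expr2 -scalerA -rotationZ.
exact: (LL' _ (LL' _ Lv)).
Qed.

(** * Lattice-compatible rotations in nearly every direction *)

Lemma cos_near0 (e : R) : 0 < e ->
  exists2 d : R, 0 < d & forall h, `|h| < d -> 1 - e < cos h.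
Proof.
move=> e0; have := @continuous_cos R 0; rewrite /continuous_at cos0.
move=> /cvgrPdist_lt /(_ e e0) /nbhs_ballP[d /= d0 hd].
exists d => // h hh; have := hd h; rewrite /ball /= sub0r normrN => /(_ hh).
by rewrite ltr_norml => /andP[_]; lra.
Qed.

(* An angle [a] of the rotatability hypothesis may have an irrational scaling
   factor, but its double has an integer one: hence finitely many doubled
   angles, dense up to [e], share one scaling factor [n]. *)
Lemma rotatable_common_multiple L (e : R) : is_lattice L -> rotatable L -> 0 < e ->
  exists2 n : nat, (0 < n)%N & forall t, 0 <= t < pi *+ 2 ->
    exists2 a, (forall v, L v -> L (n%:R *: rotation a v)) & 1 - e < cos (t - a).
Proof.
move=> hL rL e0; have [d d0 hd] := cos_near0 e0.
have pi0 := pi_gt0 R.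
pose M := (Num.truncn (pi *+ 2 / d)).+1.
have M0 : 0 < M%:R :> R by rewrite ltr0n.
have Md : pi *+ 2 / M%:R < d.
  rewrite ltr_pdivrMr// mulrC -ltr_pdivrMr//.
  have q0 : 0 <= pi *+ 2 / d.
    by apply: divr_ge0; [apply: mulrn_wge0; exact: ltW|exact: ltW].
  by rewrite -(truncn_lt_nat _ q0).
(* One angle for each of the [M] slots of the full turn; the scaling factors are multiplied up, as
   [L] is closed under natural multiples. *)
have /(_ M (leqnn M))[n n0 hn] : forall k, (k <= M)%N ->
    exists2 n : nat, (0 < n)%N & forall j, (j < k)%N ->
    exists2 a, (forall v, L v -> L (n%:R *: rotation a v)) &
      pi *+ 2 * (j%:R / M%:R) < a < pi *+ 2 * (j.+1%:R / M%:R).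
  elim=> [|j IH] jM; first by exists 1%N => // j; rewrite ltn0.
  have [n n0 hn] := IH (ltnW jM).
  have [||| a [l [a1 a2 l0 La]]] := rL (pi * (j%:R / M%:R)) (pi * (j.+1%:R / M%:R)).
  - by apply: mulr_ge0; [exact: ltW|apply: divr_ge0; exact: ler0n].
  - by rewrite ltr_pM2l// ltr_pM2r ?invr_gt0// ltr_nat.
  - by rewrite ler_piMr ?(ltW pi0)// ler_pdivrMr// mul1r ler_nat.
  have [m m0 hm] := lattice_double_rotation hL l0 La.
  exists (m * n)%N; first by rewrite muln_gt0 m0.
  move=> i; rewrite ltnS leq_eqVlt => /orP[/eqP->|ij].
    exists (a *+ 2); last by apply/andP; split; lra.
    by move=> v Lv; rewrite mulnC natrM -scalerA; apply: latticeMn => //; exact: hm.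
  have [b Lb bI] := hn i ij; exists b => // v Lv.
  by rewrite natrM -scalerA; apply: latticeMn => //; exact: Lb.
exists n => // t /andP[t0 t1].
pose x := t / (pi *+ 2) * M%:R.
have p20 : 0 < pi *+ 2 :> R by rewrite pmulrn_lgt0.
have x0 : 0 <= x by apply: mulr_ge0; [apply: divr_ge0 => //; exact: ltW|exact: ltW].
have xM : (Num.truncn x < M)%N.
  by rewrite truncn_lt_nat// /x gtr_pMl// ltr_pdivrMr// mul1r.
have [a La aI] := hn _ xM; exists a => //; apply: hd.
have := truncn_itv x0; move: aI; set j := Num.truncn x.
have tE : t = pi *+ 2 * (x / M%:R).
  by rewrite /x mulfK ?gt_eqF// mulrC divfK// gt_eqF.
move=> /andP[a1 a2] /andP[j1 j2].
have b1 : pi *+ 2 * (j%:R / M%:R) <= t.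
  by rewrite tE ler_pM2l// ler_pM2r// invr_gt0.
have b2 : t < pi *+ 2 * (j.+1%:R / M%:R).
  by rewrite tE ltr_pM2l// ltr_pM2r// invr_gt0.
have b3 : pi *+ 2 * (j.+1%:R / M%:R) =
    pi *+ 2 * (j%:R / M%:R) + pi *+ 2 / M%:R :> R.
  by rewrite -natr1; ring.
by rewrite ltr_norml; apply/andP; split; lra.
Qed.

(** Turn [u] nearly opposite to [x]. Each [w] has a component along [u] bounded below, so for long
    [x] the product of [x] with the rotated [w] is at most -1, and the squared length changes by at
    most -2 + 1. *)
Lemma inward_rotation L (s : seq 'rV[R]_2) u : is_lattice L -> rotatable L ->
  u != 0 -> (forall w, w \in s -> dot w w = 1 /\ 0 < dot u w) ->
  exists2 n : nat, (0 < n)%N & exists r : R, forall x, r < dot x x ->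
    exists2 a, (forall v, L v -> L (n%:R *: rotation a v)) &
      forall w, w \in s -> dot (x + rotation a w) (x + rotation a w) <= dot x x - 1.
Proof.
move=> hL rL u0 hs.
have U0 : 0 < dot u u.
  by rewrite lt_neqAle dot_ge0 andbT eq_sym; apply: contraNneq u0 => /dot_eq0->.
have [c c0 cs] := @seq_strict_lower_bound 0 [seq dot u w | w <- s]
  (fun b => ltac:(by move=> /mapP[w /hs[_ ?] ->])).
have {}cs w : w \in s -> c < dot u w by move=> ws; apply: cs; rewrite map_f.
pose U := Num.sqrt (dot u u).
have UU : U ^+ 2 = dot u u by rewrite sqr_sqrtr// ltW.
have Up : 0 < U by rewrite sqrtr_gt0.
(* Chosen so that an angle error [h] has [cos h >= 1/2] and [|sin h| <= c / (4 * U)]: the main term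
   is then at least [c / 2], the error at most [c / 4]. *)
pose e := Num.min (1/2) (c ^+ 2 / (32 * dot u u)).
have e0 : 0 < e.
  by rewrite lt_min; apply/andP; split; rewrite divr_gt0 ?mulr_gt0 ?exprn_gt0.
have e1 : e <= 1/2 by rewrite ge_min lexx.
have e2 : e * (32 * dot u u) <= c ^+ 2.
  by rewrite -ler_pdivlMr ?mulr_gt0// ge_min lexx orbT.
have [n n0 hn] := rotatable_common_multiple hL rL e0.
(* Beyond this squared radius, [c / 4] times the length of [x] exceeds [U]. *)
exists n => //; exists (16 * dot u u / c ^+ 2) => x.
rewrite ltr_pdivrMr ?exprn_gt0// => hx.
have x0 : 0 < dot x x.
  rewrite lt_neqAle dot_ge0 andbT; apply/eqP => x0; move: hx.
  by rewrite -x0 mul0r; lra.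
pose X := Num.sqrt (dot x x).
have XX : X ^+ 2 = dot x x by rewrite sqr_sqrtr// ltW.
have Xp : 0 < X by rewrite sqrtr_gt0.
have [|t tI ut] := @rotation_onto u ((- (U / X)) *: x) _ u0.
  rewrite [RHS](_ : _ = (U / X) ^+ 2 * dot x x).
    by rewrite -UU -XX -exprMn divfK ?gt_eqF.
  by rewrite /dot !mxE; ring.
have [a La ca] := hn t tI; exists a => // w ws.
have [w1 uw] := hs w ws; have {}uw := cs w ws.
set h := t - a in ca.
have sh : `|sin h| * (4 * U) <= c.
  have sq : sin h ^+ 2 <= 2 * e.
    have := cos2Dsin2 h; have := cos_le1 h; nra.
  rewrite -(@ler_pXn2r _ 2) ?nnegrE ?mulr_ge0 ?(ltW Up) ?(ltW c0)//.
  rewrite exprMn real_normK ?num_real// exprMn UU.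
  by have := ler_wpM2r (ltW U0) sq; lra.
have dE : dot (rotation t u) (rotation a w) = cos h * dot u w + sin h * cross u w.
  rewrite (_ : t = a + h); last by rewrite /h addrC subrK.
  by rewrite rotation_add dot_rotation /dot /cross !coordE; ring.
have cw : `|cross u w| <= U.
  rewrite -(@ler_pXn2r _ 2) ?nnegrE ?(ltW Up)// real_normK ?num_real//.
  by rewrite UU (le_trans (cross_sqr_le _ _))// w1 mulr1.
have d1 : c / 4 <= dot (rotation t u) (rotation a w).
  have : - (c / 4) <= sin h * cross u w.
    have : `|sin h * cross u w| <= c / 4.
      rewrite normrM (le_trans (ler_wpM2l _ cw))//.
      by rewrite ler_pdivlMr//; lra.
    by rewrite ler_norml => /andP[].
  rewrite dE.
  have : c / 2 <= cos h * dot u w by nra.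
  lra.
have d2 : dot (rotation t u) (rotation a w) = - (U / X) * dot x (rotation a w).
  by rewrite ut /dot !mxE; ring.
have d3 : 1 <= - dot x (rotation a w).
  have : c / 4 * X <= - dot x (rotation a w) * U.
    rewrite (_ : - _ * U = - (U / X) * dot x (rotation a w) * X).
      by rewrite ler_pM2r// -d2.
    by field; rewrite gt_eqF.
  have : U <= c / 4 * X.
    rewrite -(@ler_pXn2r _ 2) ?nnegrE ?mulr_ge0 ?divr_ge0 ?(ltW Up) ?(ltW Xp) ?(ltW c0)//.
    by rewrite exprMn XX UU; lra.
  move=> h1 h2; have := le_trans h1 h2.
  by rewrite -[X in X <= _]mul1r ler_pM2r.
have -> : dot (x + rotation a w) (x + rotation a w) =
    dot x x + 2 * dot x (rotation a w) + dot (rotation a w) (rotation a w).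
  by rewrite /dot !mxE; ring.
by rewrite dot_rotation w1; lra.
Qed.

(** * Determined colourings and their periods *)

(** In use, [s] lists the vectors from the origin of the graph to its neighbours. *)
Definition determined (T : Type) (s : seq 'rV[R]_2) (phi : 'rV[R]_2 -> T) : Prop :=
  forall a p q,
    (forall w, w \in s -> phi (p + rotation a w) = phi (q + rotation a w)) ->
    phi p = phi q.

(** The quantifier over all angles absorbs [b]. *)
Lemma determined_rotation (T : Type) s (phi : 'rV[R]_2 -> T) b :
  determined s phi -> determined s (phi \o rotation b).
Proof.
move=> D a p q h; apply: (D (b + a)) => w ws.
by have := h w ws; rewrite /= !rotationD !rotation_add.
Qed.

(* The period found by pigeonhole depends on [phi], [p] and [v], but is bounded
   by the number of patterns, whose factorial therefore always works. *)
Lemma determined_period (T : finType) L (s : seq 'rV[R]_2) u :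
  is_lattice L -> rotatable L -> u != 0 ->
  (forall w, w \in s -> [/\ L w, dot w w = 1 & 0 < dot u w]) ->
  exists2 B : nat, (0 < B)%N & forall phi : 'rV[R]_2 -> T, determined s phi ->
    forall p v, L v -> phi (p + B%:R *: v) = phi p.
Proof.
move=> hL rL u0 hs.
have [|n n0 [r hr]] := @inward_rotation L s u hL rL u0.
  by move=> w /hs[].
have N0 : n%:R != 0 :> R by rewrite pnatr_eq0 -lt0n.
have [s' hs'] := lattice_ball_finite (n%:R ^+ 2 * r) hL.
pose ds := [seq n%:R^-1 *: x | x <- s'].
have hds x : L (n%:R *: x) -> dot x x <= r -> x \in ds.
  move=> Lx xr; apply/mapP; exists (n%:R *: x).
    apply: hs' => //.
    rewrite (_ : dot _ _ = n%:R ^+ 2 * dot x x); last by rewrite /dot !mxE; ring.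
    by rewrite ler_wpM2l// sqr_ge0.
  by rewrite scalerA mulVf// scale1r.
(* Agreement spreads from the disc to all of [n^-1 L]: the inward rotation reduces [x] to points
   whose squared length is smaller by at least 1, hence the induction on [m]. *)
have ext (phi : 'rV[R]_2 -> T) p q : determined s phi ->
    (forall x, x \in ds -> phi (p + x) = phi (q + x)) ->
    forall x, L (n%:R *: x) -> phi (p + x) = phi (q + x).
  move=> D h x Lx.
  have [m] : exists m : nat, dot x x <= r + m%:R.
    exists (Num.truncn `|dot x x - r|).+1.
    have := truncnS_gt `|dot x x - r|; have := ler_norm (dot x x - r); lra.
  elim: m x Lx => [|m IH] x Lx hx; first by apply/h/hds; rewrite ?addr0 in hx *.
  have [xr|xr] := leP (dot x x) r; first by apply/h/hds.
  have [a La ha] := hr x xr.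
  apply: (D a) => w ws; rewrite -!addrA; apply: IH.
    by rewrite scalerDr; apply: latticeD => //; apply: La; case: (hs w ws).
  by have := ha w ws; rewrite -natr1 in hx; lra.
pose N := #|{ffun 'I_(size ds) -> T}|.
exists N`!; first exact: fact_gt0.
move=> phi D p v Lv.
pose pat (j : 'I_N.+1) := [ffun i : 'I_(size ds) => phi (p + j%:R *: v + nth 0 ds i)].
have /injectivePn[i0 [j0 ij0 pij0]] : ~~ injectiveb pat.
  by apply/injectiveP => /leq_card; rewrite card_ord ltnn.
have {i0 j0 ij0 pij0} [i [j [ij pij]]] : exists i j : 'I_N.+1, (i < j)%N /\ pat i = pat j.
  move: ij0; rewrite neq_ltn => /orP[h|h]; first by exists i0, j0.
  by exists j0, i0.
pose d := (j - i)%N.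
(* Equal patterns at [i] and [j] extend to the whole coset; the point [(m - i) v] gives the shift by
   [d], also for [m < i]. *)
have per m : phi (p + (m + d)%:R *: v) = phi (p + m%:R *: v).
  have /= := @ext phi (p + i%:R *: v) (p + j%:R *: v) D _ ((m%:R - i%:R) *: v).
  move=> h; have {h} := h _ _; rewrite -!addrA -!scalerDl.
  rewrite (_ : i%:R + (m%:R - i%:R) = m%:R); last by ring.
  rewrite (_ : j%:R + (m%:R - i%:R) = (m + d)%:R); last first.
    by rewrite natrD natrB 1?ltnW//; ring.
  move=> -> //; last first.
    by rewrite scalerBl scalerBr; apply: latticeB => //; do 2 apply: latticeMn => //.
  move=> x xds; have ix : (index x ds < size ds)%N by rewrite index_mem.
  by have /ffunP/(_ (Ordinal ix)) := pij; rewrite !ffunE /= nth_index.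
have dN : (d %| N`!)%N.
  by rewrite dvdn_fact// subn_gt0 ij /=; have := ltn_ord j; rewrite /d; lia.
rewrite -(divnK dN); elim: (N`! %/ d)%N => [|m IH]; first by rewrite mul0n scale0r addr0.
by rewrite mulSn addnC per.
Qed.

(** The unit vector [(1, 0)] is the sum of [(1/2, h)] and [(1/2, -h)], both as long as [w] and so
    rotations of [w]. *)
Lemma rotation_periods_not_proper (T : Type) (phi : 'rV[R]_2 -> T) w :
  1 <= dot w w -> (forall b p, phi (p + rotation b w) = phi p) ->
  exists p q, enorm (p - q) = 1 /\ phi p = phi q.
Proof.
move=> w1 per; have w0 : w != 0.
  by apply: contraTneq w1 => ->; rewrite /dot !mxE !mul0r addr0 ler10.
pose h := Num.sqrt (dot w w - 1 / 4).
have hh : h ^+ 2 = dot w w - 1 / 4 by rewrite sqr_sqrtr//; lra.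
pose x e : 'rV[R]_2 := \row_j (if j == 0 then 1 / 2 else e).
have xper e p : e ^+ 2 = h ^+ 2 -> phi (p + x e) = phi p.
  move=> eh; have [|b _ <-] := @rotation_onto w (x e) _ w0; last exact: per.
  by rewrite [RHS]/dot !mxE /= -[e * e]expr2 eh hh; field.
exists (0 + x h + x (- h)), 0; rewrite !xper// ?sqrrN//; split=> //.
by apply/enorm_eq1; rewrite /dot !mxE /=; field.
Qed.

End Plane.

(** * From a missing bichromatic colouring to a lower bound *)

Theorem theorem5p4 (R : realType) (k : nat) :
  (exists (G : unit_distance_graph R) (v0 : 'rV[R]_2),
     [/\ vertices G v0, lattice_like G v0 &
         ~ exists c : 'rV[R]_2 -> {set 'I_k},
             bichromatic_origin_coloring G v0 c]) ->
  (k.+1 <= plane_chromatic_number R)%N.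
Proof.
move=> [G [v0 [_ [[L [hL rL Lv0 NL]] hull] nc]]].
rewrite /plane_chromatic_number; case: ex_minnP => m /asboolP[psi psiP] _.
rewrite ltnNge; apply/negP => mk.
pose phi p : 'I_k := widen_ord mk (psi p).
have phiP p q : enorm (p - q) = 1 -> phi p <> phi q.
  by move=> /psiP h /(congr1 val) e; apply: h; apply: val_inj.
have unitG v w : adj G v w -> dot (w - v) (w - v) = 1.
  by move=> /adj_sym/adj_unit/enorm_eq1.
have [l hl] := lattice_ball_finite 1 hL.
(* Neighbours differ from [v0] by unit vectors of [L], so this finite list captures them all. *)
pose s := [seq w <- l | `[< adj G v0 (v0 + w) >]].
have sP w : (w \in s) <-> adj G v0 (v0 + w).
  rewrite mem_filter; split=> [/andP[/asboolP]//|vw].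
  have := unitG _ _ vw; rewrite addrAC subrr add0r => w1.
  apply/andP; split; first exact/asboolP.
  apply: hl; last by rewrite w1.
  by rewrite -[w](addKr v0) addrC; apply: latticeB => //; exact: NL.
have D : determined s phi.
  move=> a p q h; apply: contrapT => pq; apply: nc.
  (* The copy of [G] is placed at [p]. A neighbour of [v0] avoids [phi p] by distance, and [phi q]
     because it has the same colour in the copy placed at [q]. *)
  exists (fun v => if v == v0 then [set phi p; phi q]%SET
                   else [set phi (p + rotation a (v - v0))]%SET).
  have key w : adj G v0 w ->
      phi (p + rotation a (w - v0)) \notin [set phi p; phi q]%SET.
    move=> v0w; have ws : w - v0 \in s by apply/sP; rewrite addrC subrK.
    have far x : phi (x + rotation a (w - v0)) != phi x.
      apply/eqP/phiP/enorm_eq1; rewrite addrAC subrr add0r dot_rotation.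
      exact: unitG.
    by rewrite !inE negb_or far h //= far.
  split=> [|v _ /eqP/negPf->|v w vw].
  - by rewrite eqxx cards2; move/eqP: pq => ->.
  - by rewrite cards1.
  have nvw : v != w.
    apply/eqP => e; have := unitG _ _ vw; rewrite e subrr /dot !mxE mul0r addr0.
    by move/esym/eqP; rewrite oner_eq0.
  have [ve|vn] := eqVneq v v0; have [we|wn] := eqVneq w v0.
  - by rewrite ve we eqxx in nvw.
  - by rewrite disjoint_sym disjoints1; apply: key; rewrite -ve.
  - by rewrite disjoints1; apply: key; rewrite -we; exact: adj_sym.
  rewrite disjoints1 inE; apply/eqP/phiP/enorm_eq1.
  rewrite opprD addrACA subrr add0r -rotationB dot_rotation opprB addrA subrK.
  by apply: unitG; exact: adj_sym.
have [w0 w0s] : exists w, w \in s.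
  apply: contrapT => ns.
  (* Without neighbours [D] would make [phi] constant, so every vector would be a period. *)
  have [||p [q []]] := @rotation_periods_not_proper R _ phi (\row_j 1).
  - by rewrite /dot !mxE; lra.
  - by move=> b p; apply: (D 0) => w ws; case: ns; exists w.
  - by move=> /phiP.
have sub w : w \in s -> v0 + w \in [seq v0 + w | w <- s] by move=> ws; rewrite map_f.
have [|u hu] := @finite_hull_separation R [seq v0 + w | w <- s] v0.
  rewrite (_ : [set` _] = neighbours G v0)//; apply/seteqP; split=> [w|w] /=.
    by move=> /mapP[x /sP v0x ->].
  move=> v0w; rewrite -[w](subrK v0) addrC; apply/sub/sP.
  by rewrite addrC subrK.
have {hu} hu w : w \in s -> [/\ L w, dot w w = 1 & 0 < dot u w].
  move=> ws; have := hu _ (sub _ ws); rewrite addrAC subrr add0r => uw.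
  move/sP: ws => v0w; have := unitG _ _ v0w; rewrite addrAC subrr add0r => w1.
  split=> //; rewrite -[w](addKr v0) addrC; apply: latticeB => //; exact: NL.
have u0 : u != 0.
  have [_ _] := hu _ w0s; apply: contraTneq => ->.
  by rewrite /dot !mxE !mul0r addr0 ltxx.
have [B B0 hB] := @determined_period R 'I_k L s u hL rL u0 hu.
have [Lw0 w01 _] := hu _ w0s.
have [||p [q [/phiP]]] := @rotation_periods_not_proper R _ phi (B%:R *: w0); last by [].
  rewrite (_ : dot _ _ = B%:R ^+ 2 * dot w0 w0); last by rewrite /dot !mxE; ring.
  by rewrite w01 mulr1 exprn_ege1// ler1n.
(* The period [B w0] of [phi] composed with [rotation b], read at [rotation (- b) p], is the period
   [rotation b (B w0)] of [phi] at [p]. *)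
move=> b p; have := hB _ (determined_rotation (b := b) D) (rotation (- b) p) _ Lw0.
by rewrite /= rotationD -rotation_add subrr rotation0.
Qed.
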